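(* Let $q \in \mathbb{Q}^+$ be written as the irreducible fraction $q = \frac{c}{d}$ with $c,d$ positive integers. For $n \ge 0$ let $\mathcal{W}_{q,n}$ be the set of binary words of length $n$ such that for every maximal factor of the form $0^a1^b$ with $a>0$ one has $aq > b$, and let $w_n = |\mathcal{W}_{q,n}|$; set $w_n = 0$ for $n < 0$. Let $J$ be the set of exponents appearing in the polynomial $P_q(x,x) = \sum_{i=0}^{c-1} x^{1+\lfloor i/q\rfloor + i}$ (e.g. for $q = 3/2$, $P_q(x,x) = x + x^2 + x^4$ and $J = \{1,2,4\}$). Then for all $n \ge c+d$, $$w_n = \sum_{j \in J} w_{n-j} + w_{n-(c+d)},$$ and for $0 \le n < c+d$, $$w_n = \sum_{j \in J} w_{n-j} + w_{n-(c+d)} + 1.$$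
   Context: Here $x^\ell$ denotes the word consisting of $\ell$ copies of the symbol $x$. A maximal factor of the form $0^a1^b$ means a maximal run of $a$ consecutive zeros followed immediately by the maximal run of $b \ge 0$ consecutive ones following it. $\mathcal{W}_{q,0}$ consists of the empty word. *)

(* Defs.v *)
From mathcomp Require Import all_boot all_order all_algebra.

Set Implicit Arguments.
Unset Strict Implicit.
Unset Printing Implicit Defensive.

Import Order.TTheory GRing.Theory Num.Theory.

Local Open Scope ring_scope.

(* Binary words are sequences of booleans, false being 0 and true being 1.
   [max_factor u a b v] says that in the word u 0^a 1^b v, for a > 0, the
   displayed zeros form a maximal run and the displayed ones are all the ones
   that follow it.  When b = 0 the last two conditions force v to be empty. *)
Definition max_factor (u : seq bool) (a b : nat) (v : seq bool) : bool :=
  [&& last true u, head true (nseq b true ++ v) & ~~ head false v].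

(* Occurrences of factors are given by a position k and the exponents a, b, all
   at most the length of the word, so that admissibility is decidable;
   [admissibleP] is the unbounded form. *)
Definition admissible (q : rat) (s : seq bool) : bool :=
  [forall k : 'I_(size s).+1, forall a : 'I_(size s).+1,
   forall b : 'I_(size s).+1,
     let u := take k s in let v := drop (k + a + b) s in
     [&& s == u ++ nseq a false ++ nseq b true ++ v,
         (0 < a)%N & max_factor u a b v]
     ==> (b%:R < a%:R * q)].

Lemma admissibleP (q : rat) (s : seq bool) :
  reflect
    (forall (u v : seq bool) (a b : nat),
        s = u ++ nseq a false ++ nseq b true ++ v ->
        (0 < a)%N -> max_factor u a b v -> b%:R < a%:R * q)
    (admissible q s).
Proof.
apply: (iffP idP) => [H u v a b Es a0 mf | H].
- have ss : size s = (size u + (a + (b + size v)))%N.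
    by rewrite Es !size_cat !size_nseq.
  have uw : (size u < (size s).+1)%N by rewrite ss ltnS leq_addr.
  have aw : (a < (size s).+1)%N.
    by rewrite ss ltnS addnCA leq_addr.
  have bw : (b < (size s).+1)%N.
    by rewrite ss ltnS addnA addnCA leq_addr.
  move: H => /forallP /(_ (Ordinal uw)) /forallP /(_ (Ordinal aw)).
  move=> /forallP /(_ (Ordinal bw)) /implyP; apply => /=.
  have -> : take (size u) s = u by rewrite Es take_size_cat.
  have -> : drop (size u + a + b) s = v.
    rewrite Es !catA drop_size_cat //.
    by rewrite !size_cat !size_nseq.
  by rewrite -Es eqxx a0 mf.
- apply/forallP => k; apply/forallP => a; apply/forallP => b.
  by apply/implyP => /and3P[/eqP Es a0 mf]; apply: H Es a0 mf.
Qed.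

Definition W (q : rat) (n : nat) : {set n.-tuple bool} :=
  [set t : n.-tuple bool | admissible q t].

Definition w (q : rat) (n : int) : nat :=
  match n with Posz m => #|W q m| | Negz _ => 0%N end.

(* P_q(x,x); the floor is that of a nonnegative rational. *)
Definition Pxx (q : rat) (c : nat) : {poly int} :=
  \sum_(i < c) 'X^(1 + `|Num.floor (i%:R / q)|%N + i).

Definition exponents (p : {poly int}) : seq nat :=
  [seq j <- iota 0 (size p) | p`_j != 0].

(* Main.v *)
(* An admissible word is a block of ones followed by atoms 0^(floor(b/q)+1) 1^b
   with b >= 0, in a unique way: a block 0^a 1^b with aq > b is the atom of b
   preceded by copies of the atom 0.  Removing the last atom gives
     w_n = 1 + sum_(b >= 0) w_(n - (1 + floor(b/q) + b)).
   Since floor((b+c)/q) = floor(b/q) + d, the terms with b >= c form the same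
   sum for n - (c+d), so they add up to w_(n-(c+d)) - 1 when n >= c+d, and to 0
   otherwise. *)
Require Import Defs.
From mathcomp Require Import all_boot all_order all_algebra.
From mathcomp Require Import zify.

Set Implicit Arguments.
Unset Strict Implicit.
Unset Printing Implicit Defensive.

Import Order.TTheory GRing.Theory Num.Theory.

Local Open Scope ring_scope.

(** * Words and their final runs *)

Lemma cat_eq_cat (T : Type) (s1 s2 t1 t2 : seq T) :
  s1 ++ s2 = t1 ++ t2 -> (size s1 <= size t1)%N ->
  exists2 r, t1 = s1 ++ r & s2 = r ++ t2.
Proof.
elim: s1 t1 => [|x s1 IH] [|y t1] //=; first by move=> ->; exists [::].
- by move=> ->; exists (y :: t1).
- by case=> -> /IH h /h[r -> ->]; exists r.
Qed.

Lemma rcons_nseq (T : Type) (n : nat) (x : T) :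
  rcons (nseq n x) x = nseq n.+1 x.
Proof. by elim: n => //= n ->. Qed.

Lemma trailing_run (x : bool) (s : seq bool) :
  exists k r, s = r ++ nseq k x /\ last (~~ x) r = ~~ x.
Proof.
elim/last_ind: s => [|s y [k [r [-> lr]]]]; first by exists 0, [::].
have [->|neq_yx] := eqVneq y x.
  by exists k.+1, r; rewrite rcons_cat rcons_nseq.
exists 0, (rcons (r ++ nseq k x) y); rewrite cats0 last_rcons; split=> //.
by case: x y neq_yx {lr} => [] [].
Qed.

(** Without a zero, [find] returns the size, so a word of ones gets its own length. For other
    admissible words this value determines the last atom. *)
Definition trailing_ones (s : seq bool) : nat := find negb (rev s).

Lemma trailing_ones_cat (s : seq bool) (b : nat) :
  last false s = false -> trailing_ones (s ++ nseq b true) = b.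
Proof.
move=> ls; rewrite /trailing_ones rev_cat rev_nseq find_cat has_nseq andbF.
rewrite size_nseq; case/lastP: s ls => [|s x]; first by rewrite addn0.
by rewrite last_rcons rev_rcons => -> /=; rewrite addn0.
Qed.

(** * Floors and atom sizes *)

Definition floor_quo (q : rat) (b : nat) : nat := `|Num.floor (b%:R / q)|%N.

Definition atom (q : rat) (b : nat) : seq bool :=
  nseq (floor_quo q b).+1 false ++ nseq b true.

Definition atom_size (q : rat) (b : nat) : nat := (1 + floor_quo q b + b)%N.

Lemma size_atom (q : rat) (b : nat) : size (atom q b) = atom_size q b.
Proof. by rewrite size_cat !size_nseq. Qed.

Lemma floor_quoE (q : rat) (b : nat) :
  0 < q -> (floor_quo q b)%:Z = Num.floor (b%:R / q).
Proof.
by move=> q0; rewrite gez0_abs // floor_ge0 divr_ge0 ?ler0n // ltW.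
Qed.

(** Thus [(floor_quo q b).+1], the number of zeros in [atom q b], is the least number allowed before
    [b] ones. *)
Lemma floor_quo_lt (q : rat) (a b : nat) :
  0 < q -> (floor_quo q b < a)%N = (b%:R < a%:R * q).
Proof.
by move=> q0; rewrite -ltz_nat floor_quoE // floor_lt_int ltr_pdivrMr.
Qed.

Lemma floor_quoD (q : rat) (c d b : nat) :
  0 < q -> c%:R / q = d%:R -> floor_quo q (c + b) = (d + floor_quo q b)%N.
Proof.
move=> q0 cqd; apply/eqP; rewrite -eqz_nat PoszD !floor_quoE //.
by rewrite natrD mulrDl cqd floorDzr ?natr_int // (intrKfloor d%:Z).
Qed.

Lemma leq_floor_quo (q : rat) :
  0 < q -> {homo floor_quo q : b b' / (b <= b')%N}.
Proof.
move=> q0 b b' le_bb'; rewrite -lez_nat !floor_quoE //.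
by rewrite le_floor // ler_wpM2r ?ler_nat // invr_ge0 ltW.
Qed.

Lemma atom_size_inj (q : rat) : 0 < q -> injective (atom_size q).
Proof.
move=> q0 b b'; rewrite /atom_size.
by case: (leqP b b') => [|/ltnW] le_b; have := leq_floor_quo q0 le_b; lia.
Qed.

(** * Appending and removing an atom *)

Lemma trailing_ones_atom (q : rat) (s : seq bool) (b : nat) :
  trailing_ones (s ++ atom q b) = b.
Proof.
by rewrite /atom -rcons_nseq catA trailing_ones_cat // -rcons_cat last_rcons.
Qed.

Lemma admissible_nseq_true (q : rat) (n : nat) : admissible q (nseq n true).
Proof.
apply/admissibleP => u v [|a] b // Es _ _.
have : false \in nseq n true by rewrite Es !mem_cat in_cons eqxx /= orbT.
by rewrite mem_nseq andbF.
Qed.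

(** The atom starts with a zero, so maximal factors of [s] that contain ones stay maximal. The only
    other factor with ones ends the word and has at least as many zeros as the atom. Factors without
    ones satisfy the bound by positivity. *)
Lemma admissible_cat_atom (q : rat) (s : seq bool) (b : nat) :
  0 < q -> admissible q (s ++ atom q b) = admissible q s.
Proof.
move=> q0; apply/admissibleP/admissibleP => H u v a [|b'] Es a0 mf;
  try by rewrite mulr_gt0 // ltr0n.
  apply: (H u (v ++ atom q b)) => //; first by rewrite Es -!catA.
  by move: mf; rewrite /max_factor /=; case: (v).
have [v0|vN0] := eqVneq v [::].
  move: Es mf; rewrite v0 cats0 => Es /and3P[lu _ _].
  have lastf : forall t k, last false (t ++ nseq k.+1 false) = false.
    by move=> t k; rewrite -rcons_nseq last_cat last_rcons.
  case: a a0 Es => // a _; rewrite /atom !catA => Es.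
  have bb' : b = b'.+1.
    by rewrite -(trailing_ones_cat b (lastf s (floor_quo q b))) Es
      trailing_ones_cat.
  rewrite -{}bb' in Es *; rewrite -floor_quo_lt //.
  have sz : (size s + (floor_quo q b).+1 = size u + a.+1)%N.
    apply: (@addIn b); move/(congr1 size): Es.
    by rewrite !size_cat !size_nseq.
  move/eqP: Es; rewrite eqseq_cat; last by rewrite !size_cat !size_nseq.
  (* With too few zeros, [u] would extend [s] by a nonempty block of zeros of the atom and so end in
     a zero, against maximality. *)
  case/andP=> /eqP Es _; rewrite ltnNge; apply/negP => lt_a.
  have [|r uE rE] := @cat_eq_cat bool _ _ _ _ Es; first by lia.
  move: lu; rewrite uE; case/lastP: r uE rE => [uE _|r x _ rE].
    by move: sz; rewrite uE cats0; lia.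
  have : x \in nseq (floor_quo q b).+1 false.
    by rewrite rE mem_cat mem_rcons mem_head.
  by rewrite mem_nseq last_cat last_rcons => /eqP ->.
have [le_ps|lt_sp] :=
  leqP (size (u ++ nseq a false ++ nseq b'.+1 true)) (size s).
  have [|r rE rE'] := @cat_eq_cat bool _ v s (atom q b) _ le_ps.
    by rewrite Es -!catA.
  apply: (H u r) => //; first by rewrite rE -!catA.
  by move: mf; rewrite rE' /max_factor /=; case: r {rE rE'}.
(* The factor reaches into the atom and is followed by a zero of it, so it would
   end in a zero. *)
have [|t pE atomE] := @cat_eq_cat bool s (atom q b) _ v _ (ltnW lt_sp).
  by rewrite Es -!catA.
case: v vN0 mf atomE {Es} => [|[] v] //= _ mf.
  by rewrite /max_factor andbF in mf.
case/lastP: t pE => [pE|t x pE atomE]; first by rewrite pE cats0 ltnn in lt_sp.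
have {pE} xE : x = true.
  have := congr1 (last true) pE.
  by rewrite -rcons_nseq -!rcons_cat !last_rcons => ->.
(* The atom would have a one at index [size t] and a zero at the next, although its zeros come
   first. The default [true] also settles an index past its end. *)
have := congr1 (fun l => nth true l (size t).+1) atomE.
have := congr1 (fun l => nth false l (size t)) atomE.
rewrite cat_rcons !nth_cat ltnn (ltnNge _.+1 (size t)) leqnSn subnn subSnn.
rewrite !size_nseq !nth_nseq /=.
rewrite xE; case: ltnP => [_|le_t] //= _; case: ltnP => [?|_]; first by lia.
by case: ifP.
Qed.

(** Strip the final ones, then the zeros before them. If there are such zeros, both runs form a
    maximal factor, so the bound leaves enough zeros for an atom. *)
Lemma admissible_atomP (q : rat) (s : seq bool) :
  0 < q -> admissible q s ->
  s = nseq (size s) true \/ exists s', s = s' ++ atom q (trailing_ones s).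
Proof.
move=> q0 /admissibleP adm; have [b [r [sE lr]]] := trailing_run true s.
have [a [u [rE lu]]] := trailing_run false r.
case: a rE => [|a] rE.
  (* A nonempty [r] would end in a zero by [lr] and in a one by [lu]. *)
  left; rewrite rE cats0 in sE lr; rewrite sE size_cat size_nseq.
  by case/lastP: u lu lr {rE sE} => // u x; rewrite !last_rcons => ->.
have bE : trailing_ones s = b.
  by rewrite sE trailing_ones_cat // rE -rcons_nseq last_cat last_rcons.
(* Of the [a.+1] zeros the atom takes [(floor_quo q b).+1]; the surplus stays in the prefix. *)
right; exists (u ++ nseq (a - floor_quo q b) false).
have : b%:R < a.+1%:R * q.
  apply: (adm u [::]); rewrite ?cats0 // -?catA; first by rewrite sE rE -catA.
  by rewrite /max_factor cats0; case: (b) => [|?]; rewrite /= andbT; apply: lu.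
rewrite -floor_quo_lt // => lt_a; rewrite bE /atom -catA (catA (nseq _ _)).
rewrite -nseqD.
have -> : (a - floor_quo q b + (floor_quo q b).+1 = a.+1)%N by lia.
by rewrite catA -rE.
Qed.

(** * Counting by the last atom *)

Lemma card_W_trailing_ones (q : rat) (n b : nat) :
  0 < q -> (b < n)%N ->
  #|[set t in W q n | trailing_ones t == b]| = w q (n%:Z - (atom_size q b)%:Z).
Proof.
move=> q0 lt_bn.
have splitW (t : n.-tuple bool) : t \in W q n -> trailing_ones t = b ->
    exists s', tval t = s' ++ atom q b.
  rewrite inE => /(admissible_atomP q0) [tE|[s' tE]] tb; last first.
    by exists s'; rewrite -tb.
  by move: lt_bn; rewrite -tb tE (@trailing_ones_cat [::]) // size_tuple ltnn.
(* If the atom is longer than [n], both sides vanish; otherwise appending it is a bijection from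
   [W q k]. *)
have [le_an|lt_na] := leqP (atom_size q b) n; last first.
  have -> : n%:Z - (atom_size q b)%:Z = Negz (atom_size q b - n).-1 by lia.
  apply/eqP; rewrite cards_eq0; apply/eqP/setP => t; rewrite [RHS]inE in_set.
  apply/andP => -[/splitW tW /eqP/tW [s' tE]].
  by have := size_tuple t; rewrite tE size_cat size_atom; lia.
have [k nE] : exists k, n = (k + atom_size q b)%N.
  by exists (n - atom_size q b)%N; rewrite subnK.
subst n; rewrite PoszD addrK /=.
pose g (t : k.-tuple bool) := cat_tuple t (Tuple (introT eqP (size_atom q b))).
have g_inj : injective g.
  move=> t t' /(congr1 val) /= /eqP.
  by rewrite eqseq_cat ?size_tuple // => /andP[/eqP /val_inj].
rewrite -(card_imset _ g_inj); congr #|pred_of_set _|; apply/setP => t.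
apply/idP/imsetP => [|[t' t'W ->]]; last first.
  rewrite !inE admissible_cat_atom // trailing_ones_atom eqxx andbT.
  by rewrite inE in t'W.
rewrite inE => /andP[tW /eqP tb]; have [s' tE] := splitW t tW tb.
have sz : size s' == k.
  by have := size_tuple t; rewrite tE size_cat size_atom => /addIn ->.
exists (Tuple sz); last by apply: val_inj; rewrite /= tE.
by move: tW; rewrite !inE tE admissible_cat_atom.
Qed.

(** Words are sorted by [trailing_ones], from 0 to [n]; the value [n] is reached only by the word of
    ones, which gives the 1. *)
Lemma card_W (q : rat) (n : nat) :
  0 < q ->
  #|W q n| = (1 + \sum_(b < n) w q (n%:Z - (atom_size q b)%:Z)%R)%N.
Proof.
move=> q0; have le_t (t : n.-tuple bool) : (trailing_ones t < n.+1)%N.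
  by rewrite ltnS -[X in (_ <= X)%N](size_tuple t) -size_rev find_size.
rewrite -sum1_card (partition_big (fun t => Ordinal (le_t t)) xpredT) //=.
rewrite big_ord_recr /= addnC; congr (_ + _)%N; last first.
  apply: eq_bigr => b _; rewrite -card_W_trailing_ones // -sum1_card.
  by apply: eq_bigl => t; rewrite !inE.
rewrite (big_pred1 [tuple of nseq n true]) // => t /=; rewrite -!val_eqE /= inE.
apply/andP/eqP => [[tW /eqP tn]|->]; last first.
  by rewrite admissible_nseq_true (@trailing_ones_cat [::]).
have [|[s' tE]] := admissible_atomP q0 tW; first by rewrite size_tuple.
by have := size_tuple t; rewrite tE size_cat size_atom tn /atom_size; lia.
Qed.

(** Since [atom_size q b] exceeds [b], terms with [b >= n] vanish, so the range can be enlarged at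
    will. *)
Lemma w_recurrence (q : rat) (n N : nat) :
  0 < q -> (n <= N)%N ->
  w q n%:Z = (1 + \sum_(0 <= b < N) w q (n%:Z - (atom_size q b)%:Z)%R)%N.
Proof.
move=> q0 le_nN; rewrite /= card_W //.
rewrite (big_cat_nat (leq0n n) le_nN) //= big_mkord.
rewrite [in RHS](@big1_seq _ _ _ _ (index_iota n N)) ?addn0 // => b.
rewrite mem_index_iota => /= /andP[le_nb _].
have -> // : n%:Z - (atom_size q b)%:Z = Negz (atom_size q b - n).-1.
by rewrite /atom_size; lia.
Qed.

(** The monomials have distinct exponents by [atom_size_inj], and their nonnegative coefficients
    cannot cancel. *)
Lemma sum_exponents (q : rat) (c : nat) (F : nat -> nat) :
  0 < q ->
  (\sum_(j <- exponents (Pxx q c)) F j = \sum_(0 <= i < c) F (atom_size q i))%N.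
Proof.
move=> q0; rewrite /index_iota subn0 -(big_map (atom_size q) xpredT).
apply: perm_big; apply: uniq_perm.
- by rewrite filter_uniq // iota_uniq.
- by rewrite map_inj_uniq ?iota_uniq //; apply: atom_size_inj.
move=> j; rewrite mem_filter mem_iota add0n /=.
rewrite andb_idr; last first.
  by apply: contraR; rewrite -leqNgt => /(nth_default 0) ->.
rewrite /Pxx coef_sum.
rewrite (eq_bigr (fun i : 'I_c => (j == atom_size q i)%:R)); last first.
  by move=> i _; rewrite coefXn.
rewrite psumr_neq0 => [|i _]; last by rewrite ler0n.
apply/hasP/mapP => [[i _]|[i]].
  rewrite ltr0n lt0b => /eqP ->; exists (i : nat) => //.
  by rewrite mem_iota add0n ltn_ord.
rewrite mem_iota add0n => ic ->; exists (Ordinal ic).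
  by rewrite mem_index_enum.
by rewrite /= eqxx.
Qed.

Theorem theorem2 (q : rat) (c d : nat) (q_gt0 : 0 < q)
    (c_gt0 : (0 < c)%N) (d_gt0 : (0 < d)%N) (cop_cd : coprime c d)
    (qE : q = c%:R / d%:R) :
  let J := exponents (Pxx q c) in
  (forall n : nat, (c + d <= n)%N ->
     w q n%:Z =
       (\sum_(j <- J) w q (n%:Z - j%:Z)%R + w q (n%:Z - (c + d)%N%:Z)%R)%N)
  /\
  (forall n : nat, (n < c + d)%N ->
     w q n%:Z =
       (\sum_(j <- J) w q (n%:Z - j%:Z)%R + w q (n%:Z - (c + d)%N%:Z)%R + 1)%N).
Proof.
have cqd : c%:R / q = d%:R :> rat.
  by rewrite qE invf_div mulrCA divff ?mulr1 // pnatr_eq0 -lt0n.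
move=> J.
have wE n : w q n%:Z = (1 + (\sum_(j <- J) w q (n%:Z - j%:Z)%R +
    \sum_(0 <= b < n)
       w q (n%:Z - (c + d)%N%:Z - (atom_size q b)%:Z)%R))%N.
  (* The bound [c + n] leaves exactly [n] terms once the first [c] are split off. *)
  rewrite (w_recurrence q_gt0 (leq_addl c n)).
  rewrite (sum_exponents c (fun j => w q (n%:Z - j%:Z)%R) q_gt0).
  rewrite (big_cat_nat (leq0n c) (leq_addr n c)) //=.
  congr (_ + (_ + _))%N; rewrite -{1}[c]add0n big_addn addKn.
  apply: eq_bigr => b _; congr (w q _).
  by rewrite /atom_size (addnC b c) (floor_quoD _ q_gt0 cqd); lia.
split=> n nm; rewrite wE.
- have -> : n%:Z - (c + d)%N%:Z = (n - (c + d))%N%:Z by lia.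
  (* The leading 1 and the tail sum together are the recurrence for [n - (c + d)], with the larger
     range [n]. *)
  by rewrite (w_recurrence q_gt0 (leq_subr (c + d) n)) addnCA.
- rewrite addnC [X in (_ + X + _)%N]big1 => [|b _].
    by have -> : n%:Z - (c + d)%N%:Z = Negz (c + d - n).-1 by lia.
  have -> // : n%:Z - (c + d)%N%:Z - (atom_size q b)%:Z =
    Negz (c + d + atom_size q b - n).-1 by lia.
Qed.
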